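(* For every $r\ge2$ there is a bijection between the set of partitions of the highest root $\tilde\alpha_{B_r}=\varepsilon_1+\varepsilon_2$ of type $B_r$ into positive roots of $B_r$ and the set $\mathrm{JS}(\langle1,1\rangle,\langle1,1\rangle,r)$. In particular $K_{B_r}(\tilde\alpha_{B_r})=\mathsf{js}(\langle1,1\rangle,\langle1,1\rangle,r)$.
   Context: The positive roots of type $B_r$ are $\Phi^+_{B_r}=\{\varepsilon_i-\varepsilon_j,\ \varepsilon_i+\varepsilon_j:1\le i<j\le r\}\cup\{\varepsilon_i:1\le i\le r\}\subset\mathbb{R}^r$; a partition of $\mu$ is a finite multiset of positive roots summing to $\mu$, and $K_{B_r}(\mu)$ is the number of them. A juggling state is a finitely supported integer vector $\langle s_1,s_2,\dots\rangle$ indexed by heights (trailing zeros omitted). A juggling sequence of length $n$ from $\mathbf{a}$ to $\mathbf{b}$ is a sequence $(\mathbf{s}_0,\dots,\mathbf{s}_n)$ with $\mathbf{s}_0=\mathbf{a}$, $\mathbf{s}_n=\mathbf{b}$ such that for each $i$ there are nonnegative integers $c^{(i)}_k$ (finitely many nonzero) with $\sum_k c^{(i)}_k=(\mathbf{s}_{i-1})_1$ and $(\mathbf{s}_i)_k=(\mathbf{s}_{i-1})_{k+1}+c^{(i)}_k$ for all $k\ge1$. $\mathrm{JS}(\mathbf{a},\mathbf{b},n)$ is the set of these and $\mathsf{js}$ its cardinality. *)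

(* Defs.v *)
From HB Require Import structures.
From mathcomp Require Import all_boot all_order all_algebra.
Set Implicit Arguments. Unset Strict Implicit. Unset Printing Implicit Defensive.
Import Order.TTheory GRing.Theory Num.Theory.
Local Open Scope ring_scope.

Definition eps (r : nat) (i : 'I_r) : 'rV[int]_r := delta_mx 0 i.

Definition posroots (r : nat) : seq 'rV[int]_r :=
  [seq eps i - eps j | i : 'I_r <- enum 'I_r, j : 'I_r <- [seq j : 'I_r <- enum 'I_r | (i < j)%N]] ++
  [seq eps i + eps j | i : 'I_r <- enum 'I_r, j : 'I_r <- [seq j : 'I_r <- enum 'I_r | (i < j)%N]] ++
  [seq eps i | i <- enum 'I_r].

Definition PosRoot (r : nat) := seq_sub (posroots r).

Definition is_partition (r : nat) (mu : 'rV[int]_r) (m : {ffun PosRoot r -> nat}) : Prop :=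
  \sum_(a : PosRoot r) (ssval a) *+ m a = mu.

Definition highest_root_B (r : nat) : 'rV[int]_r :=
  \row_(k < r) (if (k < 2)%N then 1 else 0).

(* A juggling state <s_1, s_2, ...>, stored as the list [:: s_1; s_2; ...]
   with trailing zeros omitted. *)
Definition jstate := seq int.

Definition canonical_state (s : jstate) : bool := last 1 s != 0.

(* entry at height k >= 1 *)
Definition height (s : jstate) (k : nat) : int := nth 0 s k.-1.

Definition js_step (s t : jstate) : Prop :=
  exists c : nat -> nat,
    (exists N : nat, (forall k, (N < k)%N -> c k = 0%N) /\
                     ((\sum_(1 <= k < N.+1) c k)%N)%:Z = height s 1) /\
    (forall k, (1 <= k)%N -> height t k = height s k.+1 + (c k)%:Z).

Definition is_juggling_seq (a b : jstate) (n : nat) (ss : seq jstate) : Prop :=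
  size ss = n.+1 /\ all canonical_state ss /\
  nth [::] ss 0 = a /\ nth [::] ss n = b /\
  (forall i, (1 <= i <= n)%N -> js_step (nth [::] ss i.-1) (nth [::] ss i)).

Definition has_card (T : eqType) (P : T -> Prop) (k : nat) : Prop :=
  exists s : seq T, uniq s /\ (forall x, x \in s <-> P x) /\ size s = k.

(* Main.v *)
(** Both sides are encoded by flows of two balls on the nodes 0, ..., r-1 that
    enter at nodes 0 and 1, travel along edges i -> j with i < j, and exit at
    nodes a and b. In a partition, the edges are the roots e_i - e_j and the
    exits are given by the remaining roots, whose coefficients sum to 2: either
    e_a and e_b, or a single e_i + e_j with i < j. In a juggling sequence, node
    i stands for time i+1, an edge is a throw landing by time r, and the exits
    are the last throws of the balls that land at times r+1
    and r+2. The exits of a juggling sequence are an ordered pair (a, b); the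
    pairs with a <= b correspond to e_a and e_b, those with b < a to e_b + e_a. *)
Require Import Defs.
From HB Require Import structures.
From mathcomp Require Import all_boot all_order all_algebra.
From mathcomp Require Import zify.
From Stdlib Require Import ProofIrrelevance.
Import Order.TTheory GRing.Theory Num.Theory.
Local Open Scope ring_scope.

Set Implicit Arguments.
Unset Strict Implicit.
Unset Printing Implicit Defensive.

(** * Cardinalities of predicates *)

Lemma has_card_image (T U : eqType) (P : T -> Prop) (Q : U -> Prop)
    (f : T -> U) (k : nat) :
  (forall x y, P x -> P y -> f x = f y -> x = y) ->
  (forall x, P x -> Q (f x)) ->
  (forall y, Q y -> exists2 x, P x & y = f x) ->
  has_card P k -> has_card Q k.
Proof.
move=> finj fP fQ [s [us [sP sk]]]; exists (map f s); split; last split.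
- rewrite map_inj_in_uniq // => x y /sP Px /sP Py; exact: finj.
- move=> y; split; first by case/mapP=> x /sP Px ->; exact: fP.
  by case/fQ=> x Px ->; apply: map_f; apply/sP.
- by rewrite size_map.
Qed.

Lemma has_card_ord (T : eqType) (P : T -> Prop) (k : nat) :
  has_card P k -> exists f : 'I_k -> {x | P x}, bijective f.
Proof.
case=> s [us [sP sk]]; subst k.
have inP i : P (tnth (in_tuple s) i) by apply/sP; exact: (mem_tnth i (in_tuple s)).
have idx (x : {x | P x}) : (index (sval x) s < size s)%N.
  by rewrite index_mem; apply/sP; exact: (svalP x).
exists (fun i => exist P _ (inP i)); exists (fun x => Ordinal (idx x)).
  move=> i; apply: val_inj => /=.
  by rewrite (tnth_nth (tnth (in_tuple s) i)) /= index_uniq.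
move=> x; apply: eq_sig_hprop => [? ? ?|/=]; first exact: proof_irrelevance.
by rewrite (tnth_nth (sval x)) /= nth_index //; apply/sP; exact: (svalP x).
Qed.

(** Both sets are enumerated by the same ['I_k]. The bijection of the theorem arises this way, once
    the balanced configurations have been used to count both sides. *)
Lemma has_card_bij (T U : eqType) (P : T -> Prop) (Q : U -> Prop) (k : nat) :
  has_card P k -> has_card Q k ->
  exists f : {x | P x} -> {y | Q y}, bijective f.
Proof.
move=> /has_card_ord[f [f' fK f'K]] /has_card_ord[g gbij].
by exists (g \o f'); apply: bij_comp gbij _; exists f.
Qed.

(** * Balanced configurations and their finiteness *)

Definition config (r : nat) := ({ffun 'I_r * 'I_r -> nat} * 'I_r * 'I_r)%type.

(* d (i, j) is the multiplicity of the edge i -> j, and a and b are the exits. *)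
Definition balanced (r : nat) (x : config r) : bool :=
  let: (d, a, b) := x in
  [forall i : 'I_r, forall j : 'I_r, (j <= i)%N ==> (d (i, j) == 0%N)] &&
  [forall v : 'I_r, (\sum_j d (v, j) + (v == a) + (v == b) ==
                     (v < 2) + \sum_i d (i, v))%N].

Lemma balancedP (r : nat) (d : {ffun 'I_r * 'I_r -> nat}) (a b : 'I_r) :
  reflect ((forall i j : 'I_r, (j <= i)%N -> d (i, j) = 0%N) /\
           (forall v : 'I_r, (\sum_j d (v, j) + (v == a) + (v == b) =
                              (v < 2) + \sum_i d (i, v))%N))
          (balanced (d, a, b)).
Proof.
apply: (iffP andP) => -[d0 db]; split.
- by move=> i j ji; move/forallP/(_ i)/forallP/(_ j)/implyP/(_ ji)/eqP: d0.
- by move=> v; apply/eqP; move/forallP: db.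
- by apply/forallP=> i; apply/forallP=> j; apply/implyP=> ji; rewrite d0.
- by apply/forallP=> v; rewrite db.
Qed.

(* Weighting node v by r - v, every edge loses potential. *)
Lemma balanced_bound (r : nat) (d : {ffun 'I_r * 'I_r -> nat}) (a b : 'I_r) p :
  balanced (d, a, b) -> (d p <= r * r)%N.
Proof.
case/balancedP=> d0 db.
have H : (\sum_(v < r) (r - v) * (\sum_j d (v, j)) <=
          \sum_(v < r) r + \sum_(v < r) (r - v) * (\sum_i d (i, v)))%N.
  rewrite -big_split /=; apply: leq_sum => v _.
  apply: (@leq_trans ((r - v) * ((v < 2) + \sum_i d (i, v)))%N).
    by rewrite leq_mul2l -db -addnA leq_addr orbT.
  rewrite mulnDr leq_add2r; case: (v < 2)%N; lia.
have H1 : (\sum_(v < r) (r - v) * (\sum_i d (i, v)) + \sum_i \sum_j d (i, j) <=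
          \sum_(v < r) (r - v) * (\sum_j d (v, j)))%N.
  under [in X in (X + _)%N]eq_bigr do rewrite big_distrr.
  rewrite exchange_big -big_split /=; apply: leq_sum => i _.
  rewrite big_distrr -big_split /=; apply: leq_sum => j _.
  case: (leqP j i) => [/d0 -> | ij]; first by rewrite !muln0.
  have := ltn_ord j; nia.
(* The weighted inflow cancels between the two inequalities, and the sources account for at most [r]
   per node. *)
have {H H1} : (\sum_i \sum_j d (i, j) <= r * r)%N.
  by move: H; rewrite sum_nat_const card_ord; lia.
apply: leq_trans; case: p => i j.
by rewrite (bigD1 i) //= (bigD1 j) //= -addnA leq_addr.
Qed.

(** By [balanced_bound] all multiplicities fit in ['I_(r * r).+1], so the balanced configurations
    can be filtered out of a finite type. *)
Lemma has_card_balanced (r : nat) : exists k, has_card (@balanced r) k.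
Proof.
pose emb (x : {ffun 'I_r * 'I_r -> 'I_(r * r).+1} * 'I_r * 'I_r) : config r :=
  ([ffun p => x.1.1 p : nat], x.1.2, x.2).
have embI : injective emb.
  move=> [[d a] b] [[d' a'] b'] [/ffunP dd -> ->]; congr (_, _, _).
  by apply/ffunP=> p; apply: val_inj; have := dd p; rewrite !ffunE.
pose s := [seq x <- map emb (enum predT) | balanced x].
exists (size s), s; split; last split=> //.
  by apply: filter_uniq; rewrite map_inj_uniq // enum_uniq.
move=> x; rewrite mem_filter; split=> [/andP[] // | bx]; rewrite bx /=.
case: x bx => [[d a] b] bx; apply/mapP.
exists ([ffun p => inord (d p)], a, b); first by rewrite mem_enum.
congr (_, _, _); apply/ffunP=> p; rewrite !ffunE inordK //.
by rewrite ltnS (balanced_bound _ bx).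
Qed.

(** * Indexing the positive roots *)

Definition rootidx (r : nat) := ('I_r * 'I_r * bool)%type.

Definition root_of (r : nat) (x : rootidx r) : 'rV[int]_r :=
  let: (i, j, s) := x in
  if i == j then eps i else if s then eps i - eps j else eps i + eps j.

(** One index is kept per positive root: a pair [i < j] with either sign for the long roots, and the
    diagonal with sign [false] for the short ones. *)
Definition valid (r : nat) (x : rootidx r) : bool :=
  let: (i, j, s) := x in (i < j)%N || (i == j) && ~~ s.

Lemma root_ofE (r : nat) (i j : 'I_r) s v :
  root_of (i, j, s) 0 v =
  (i == v)%:Z + (if i == j then 0 else (-1) ^+ s * (j == v)%:Z).
Proof.
rewrite /root_of /eps; case: (i == j); rewrite ?mxE /=.
  by rewrite addr0 eq_sym; case: (_ == _).
rewrite (eq_sym i) (eq_sym j); case: s; rewrite !mxE /=;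
by case: (_ == i); case: (_ == j).
Qed.

Lemma root_of_inj (r : nat) (x y : rootidx r) :
  valid x -> valid y -> root_of x = root_of y -> x = y.
Proof.
case: x y => [[i j] s] [[i' j'] s'] vx vy /matrixP E.
have {}E v : (i == v)%:Z + (if i == j then 0 else (-1) ^+ s * (j == v)%:Z) =
    (i' == v)%:Z + (if i' == j' then 0 else (-1) ^+ s' * (j' == v)%:Z).
  by rewrite -!root_ofE E.
suff [ii jj ss] : [/\ i = i' :> nat, j = j' :> nat & s = s'].
  by rewrite (val_inj ii) (val_inj jj) ss.
(* The coordinates at the four positions involved already determine both indices. *)
have := E i; have := E i'; have := E j; have := E j'; move: vx vy {E}.
rewrite /valid -!val_eqE /=.
case: s; case: s'; case: (ssrnat.ltngtP i j) => ij //=;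
case: (ssrnat.ltngtP i' j') => ij' //= _ _; rewrite ?(expr0, expr1) => E1 E2 E3 E4.
all: split=> //; lia.
Qed.

Lemma mem_posroots (r : nat) (v : 'rV[int]_r) :
  reflect (exists2 x, valid x & v = root_of x) (v \in posroots r).
Proof.
apply: (iffP idP); rewrite /posroots !mem_cat.
  case/or3P; [case/allpairsPdep=> i [j [_]]..|case/mapP=> i _ ->].
  - rewrite mem_filter => /andP[ij _] ->; exists (i, j, true); first by rewrite /= ij.
    by rewrite /= -val_eqE ltn_eqF.
  - rewrite mem_filter => /andP[ij _] ->; exists (i, j, false); first by rewrite /= ij.
    by rewrite /= -val_eqE ltn_eqF.
  - by exists (i, i, false); rewrite /= eqxx ?orbT.
case=> -[[i j] s] /= vx ->; case: eqVneq vx => [<-|ij].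
  by move=> _; rewrite (map_f (@eps r)) ?mem_enum ?orbT.
rewrite orbF => lij; case: s; apply/or3P.
  by apply: Or31; apply/allpairsPdep; exists i, j; rewrite mem_enum mem_filter lij mem_enum.
by apply: Or32; apply/allpairsPdep; exists i, j; rewrite mem_enum mem_filter lij mem_enum.
Qed.

Arguments root_of : simpl never.

Lemma posroot_index (r : nat) (al : PosRoot r) :
  exists x : rootidx r, valid x && (root_of x == ssval al).
Proof.
have /mem_posroots[x vx e] := ssvalP al.
by exists x; rewrite vx e eqxx.
Qed.

Definition index_of (r : nat) (al : PosRoot r) : rootidx r :=
  xchoose (posroot_index al).

Lemma index_ofP (r : nat) (al : PosRoot r) :
  valid (index_of al) /\ root_of (index_of al) = ssval al.
Proof. by have /andP[? /eqP] := xchooseP (posroot_index al). Qed.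

Lemma root_of_mem (r : nat) (x : rootidx r) : valid x -> root_of x \in posroots r.
Proof. by move=> vx; apply/mem_posroots; exists x. Qed.

Lemma valid_diag (r : nat) (i : 'I_r) : valid (i, i, false).
Proof. by rewrite /= eqxx orbT. Qed.

(** [insubd] needs a default in [PosRoot r], which is empty for [r = 0]; the short root at the first
    position of [x] is always at hand. *)
Definition posroot_of (r : nat) (x : rootidx r) : PosRoot r :=
  insubd (SeqSub (root_of_mem (valid_diag x.1.1))) (root_of x).

Lemma index_ofK (r : nat) : cancel (@index_of r) (@posroot_of r).
Proof.
move=> al; have [v e] := index_ofP al; apply: val_inj.
by rewrite /= insubdK ?root_of_mem // e.
Qed.

Lemma posroot_ofK (r : nat) (x : rootidx r) : valid x -> index_of (posroot_of x) = x.
Proof.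
move=> vx; have [v e] := index_ofP (posroot_of x).
by apply: root_of_inj => //; rewrite e [LHS](@insubdK _ _ (PosRoot r)) // root_of_mem.
Qed.

(** [posroot_of] and [index_of] are mutually inverse between valid indices and positive roots, and
    the invalid indices contribute nothing. *)
Lemma sum_posroot (r : nat) (w : rootidx r -> nat) :
  (forall x, ~~ valid x -> w x = 0%N) ->
  \sum_(al : PosRoot r) ssval al *+ w (index_of al) = \sum_x root_of x *+ w x.
Proof.
move=> w0; rewrite (reindex_onto (@posroot_of r) (@index_of r)) /=; last first.
  by move=> al _; rewrite index_ofK.
rewrite [RHS](bigID (@valid r)) /= [X in _ = _ + X]big1 ?addr0; last first.
  by move=> x /w0 ->.
apply: eq_big => [x|x /eqP ex].
  by apply/eqP/idP => [<-|]; [case: (index_ofP (posroot_of x))|exact: posroot_ofK].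
by have [_ <-] := index_ofP (posroot_of x); rewrite ex.
Qed.

(** * Coordinates of sums of roots, and the exits *)

(* The coordinate at v of the root e_i + e_j (i < j) or e_i (i = j). *)
Definition incidence (r : nat) (v : 'I_r) (p : 'I_r * 'I_r) : nat :=
  ((p.1 == v) + (p.1 != p.2) * (p.2 == v))%N.

Lemma sum_incidence (r : nat) (p : 'I_r * 'I_r) :
  (\sum_v incidence v p = 1 + (p.1 != p.2))%N.
Proof.
rewrite big_split /= -big_distrr /=.
have one (i : 'I_r) : (\sum_v (i == v) = 1)%N.
  by rewrite (bigD1 i) //= eqxx big1 // => j /negPf; rewrite eq_sym => ->.
by rewrite !one muln1.
Qed.

Lemma sumz_sub (I : finType) (f g : I -> nat) :
  \sum_i ((f i)%:Z - (g i)%:Z) = (\sum_i f i)%N%:Z - (\sum_i g i)%N%:Z.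
Proof.
by elim/big_rec3: _ => [|i x y z _ ->]; rewrite ?subr0 // !PoszD opprD addrACA.
Qed.

(** The roots e_i - e_j contribute outflow minus inflow at [v], the others their incidence with [v].
    The hypothesis excludes [(i, i, true)], which [root_of] sends to e_i and not to 0. *)
Lemma sum_root_ofE (r : nat) (w : rootidx r -> nat) (v : 'I_r) :
  (forall i, w (i, i, true) = 0%N) ->
  (\sum_x root_of x *+ w x) 0 v =
    (\sum_j w (v, j, true))%N%:Z - (\sum_i w (i, v, true))%N%:Z
    + (\sum_p incidence v p * w (p, false))%N%:Z.
Proof.
move=> w0; rewrite summxE.
transitivity (\sum_p \sum_s (root_of (p, s) *+ w (p, s)) 0 v).
  by rewrite pair_bigA; apply: eq_bigr; case.
transitivity (\sum_p ((root_of (p, true) *+ w (p, true)) 0 v +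
                      (root_of (p, false) *+ w (p, false)) 0 v)).
  by apply: eq_bigr => p _; rewrite (@big_bool int 0 +%R).
rewrite big_split /=; congr (_ + _); last first.
  rewrite -natz natr_sum; apply: eq_bigr => -[i j] _.
  rewrite mulmxnE root_ofE /incidence /= natz PoszM -mulr_natr natz.
  by case: (i == j); rewrite ?expr0 ?mul1r ?mul0n ?addn0 ?mul1n ?PoszD ?addr0.
transitivity (\sum_p (((p.1 == v) * w (p, true))%N%:Z
                      - ((p.2 == v) * w (p, true))%N%:Z)).
  apply: eq_bigr => -[i j] _ /=; rewrite mulmxnE root_ofE -mulr_natr natz.
  case: (eqVneq i j) => [<-|_]; first by rewrite w0 !muln0 mulr0.
  by rewrite expr1 mulN1r mulrDl mulNr -!PoszM.
rewrite sumz_sub; congr (_%:Z - _%:Z).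
  transitivity (\sum_i \sum_j (i == v) * w (i, j, true))%N.
    by rewrite pair_bigA; apply: eq_bigr => -[].
  rewrite (bigD1 v) //= [X in (_ + X)%N]big1 ?addn0; last first.
    by move=> i /negPf iv; apply: big1 => j _; rewrite iv.
  by apply: eq_bigr => j _; rewrite eqxx mul1n.
transitivity (\sum_j \sum_i (j == v) * w (i, j, true))%N.
  by rewrite exchange_big pair_bigA; apply: eq_bigr => -[].
rewrite (bigD1 v) //= [X in (_ + X)%N]big1 ?addn0; last first.
  by move=> i /negPf iv; apply: big1 => j _; rewrite iv.
by apply: eq_bigr => j _; rewrite eqxx mul1n.
Qed.

(* Multiplicities of the roots e_i + e_j (i < j) and e_i (i = j) when the balls
   exit at a and b. *)
Definition ends (r : nat) (a b : 'I_r) (p : 'I_r * 'I_r) : nat :=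
  if (b < a)%N then nat_of_bool (p == (b, a))
  else ((p.1 == p.2) * ((p.1 == a) + (p.1 == b)))%N.

(** Both branches of [ends] describe the same vector e_a + e_b, as one long root or as two short
    ones. *)
Lemma sum_incidence_ends (r : nat) (a b v : 'I_r) :
  (\sum_p incidence v p * ends a b p = (v == a) + (v == b))%N.
Proof.
rewrite /ends; case ba: (b < a)%N.
  rewrite (bigD1 (b, a)) //= big1 ?addn0; last first.
    by move=> p /negPf ->; rewrite muln0.
  have nab : (b == a) = false by rewrite -val_eqE /= ltn_eqF.
  by rewrite /incidence eqxx /= nab muln1 mul1n addnC !(eq_sym v).
transitivity (\sum_i \sum_j incidence v (i, j) *
                (i == j) * ((i == a) + (i == b)))%N.
  by rewrite pair_bigA; apply: eq_bigr => -[i j] _ /=; rewrite mulnA.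
rewrite (bigD1 v) //= [X in (_ + X)%N]big1 ?addn0; last first.
  move=> i iv; apply: big1 => j _; rewrite /incidence /= (negPf iv).
  by case: eqVneq => [<-|]; rewrite ?muln0.
rewrite (bigD1 v) //= [X in (_ + X)%N]big1 ?addn0; last first.
  by move=> j /negPf jv; rewrite (eq_sym v j) jv muln0.
by rewrite /incidence /= eqxx !mul1n.
Qed.

(** An off-diagonal entry occurs exactly when [b < a], and its position is [(b, a)]. Otherwise the
    diagonal entries give the multiset of exits, and [a <= b] orders it. *)
Lemma ends_inj (r : nat) (a b a' b' : 'I_r) :
  (forall i j : 'I_r, (i <= j)%N -> ends a b (i, j) = ends a' b' (i, j)) ->
  a = a' /\ b = b'.
Proof.
move=> e; suff [? ?] : a = a' :> nat /\ b = b' :> nat by split; apply: val_inj.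
have := e b a; have := e b' a'; have := e a a; have := e b b.
have := e a' a'; have := e b' b'; rewrite /ends !leqnn !xpair_eqE /= !eqxx !mul1n {e}.
rewrite -!val_eqE /=; case: (ltnP b a) => ba; case: (ltnP b' a') => ba'.
- by lia.
- by rewrite (ltn_eqF ba) (ltnW ba) ?eqxx => _ _ _ _ _ /(_ isT).
- by rewrite (ltn_eqF ba') (ltnW ba') ?eqxx => _ _ _ _ /(_ isT).
- by move=> /(_ isT) ? /(_ isT) ? /(_ isT) ? /(_ isT) ? _ _; lia.
Qed.

(** Peels one element [p] off the multiset [w]; repeated use unfolds a multiset of small total
    weight. *)
Lemma sum_extract (I : finType) (c w : I -> nat) (n : nat) :
  (\sum_p c p * w p = n.+1)%N ->
  exists p (w' : I -> nat), [/\ (0 < c p)%N, forall q, w q = ((q == p) + w' q)%N &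
                  (c p + \sum_q c q * w' q = n.+1)%N].
Proof.
move=> cw; have [p /andP[cp wp]|none] := pickP (fun p => (0 < c p) && (0 < w p))%N.
  have ww q : (w q = (q == p) + (w q - (q == p)))%N.
    by case: eqP => [->|_]; lia.
  exists p, (fun q => w q - (q == p))%N; split=> //.
  rewrite -cw; under [RHS]eq_bigr => q _ do rewrite ww mulnDr.
  rewrite big_split /=; congr (_ + _)%N.
  rewrite (bigD1 p) //= eqxx muln1 big1 ?addn0 //.
  by move=> q /negPf ->; rewrite muln0.
move: cw; rewrite big1 // => p _.
by move: (none p); case: (c p) => // k /=; case: (w p); rewrite ?muln0.
Qed.

(** A total weight of 2 leaves room for a single off-diagonal pair, of weight 2, or for two diagonal
    pairs, of weight 1 each. *)
Lemma exists_ends (r : nat) (w : 'I_r * 'I_r -> nat) :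
  (forall i j : 'I_r, (j < i)%N -> w (i, j) = 0%N) ->
  (\sum_p (1 + (p.1 != p.2)) * w p = 2)%N ->
  exists a b, forall p, w p = ends a b p.
Proof.
move=> w0 /sum_extract[[i j] [w1 [_ ew /=]]].
have ij : (i <= j)%N.
  by case: leqP => // /w0; rewrite ew eqxx.
have [eij|ne] := eqVneq i j => /=; last first.
  move=> /(@addnI 2 _ 0) /eqP; rewrite sum_nat_eq0 => /forallP z.
  (* The larger position comes first, so that [ends] takes its first branch. *)
  exists j, i => -[k l]; have := z (k, l); rewrite muln_eq0 /= => /eqP z1.
  by rewrite ew z1 addn0 /ends ltn_neqAle ij val_eqE ne xpair_eqE.
subst j => /(@addnI 1 _ 1) /sum_extract[[k l] [w2 [_ ew1 /=]]].
case: eqVneq => /= ekl; last by move=> /(@addnI 1 (1 + _)%N 0).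
subst l => /(@addnI 1 _ 0) /eqP; rewrite sum_nat_eq0 => /forallP z.
have {w1 ew ew1}wE p : w p = ((p == (i, i)) + (p == (k, k)))%N.
  have := z p; rewrite muln_eq0 /= => /eqP z1.
  by rewrite ew ew1 z1 addn0.
(* The two short roots are sorted so that [ends] takes its second branch. *)
wlog ik : i k ij wE {z} / (i <= k)%N.
  move=> H; have [|/ltnW] := leqP i k; first exact: H.
  by apply: H => // p; rewrite wE addnC.
exists i, k => -[p q]; rewrite wE /ends ltnNge ik /= !xpair_eqE.
case: (eqVneq p q) => [<-|pq]; first by rewrite !andbb mul1n.
have z c : (p == c) && (q == c) = false.
  by apply: contraNF pq => /andP[/eqP -> /eqP ->].
by rewrite !z.
Qed.

(** * Partitions from balanced configurations *)

Definition weight (r : nat) (x : config r) (y : rootidx r) : nat :=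
  let: (d, a, b) := x in if y.2 then d y.1 else ends a b y.1.

Lemma weight_invalid (r : nat) (x : config r) y :
  balanced x -> ~~ valid y -> weight x y = 0%N.
Proof.
case: x y => -[d a] b [[i j] s] /balancedP[d0 _].
rewrite /valid negb_or negb_and -leqNgt => /andP[ji ns] /=.
case: s ns => /= [_|ij]; first exact: d0.
rewrite orbF in ij; rewrite /ends /= (negPf ij) mul0n; case: ifP => // ba.
apply/eqP; rewrite eqb0 xpair_eqE; apply: contraTN ji => /andP[/eqP -> /eqP ->].
by rewrite -ltnNge.
Qed.

Definition partition_of (r : nat) (x : config r) : {ffun PosRoot r -> nat} :=
  [ffun al => weight x (index_of al)].

Lemma partition_of_inj (r : nat) (x y : config r) :
  balanced x -> balanced y -> partition_of x = partition_of y -> x = y.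
Proof.
move=> bx bY /ffunP e.
have {}e z : weight x z = weight y z.
  have [vz|nz] := boolP (valid z); last by rewrite !weight_invalid.
  by have := e (posroot_of z); rewrite !ffunE posroot_ofK.
case: x y e {bx bY} => [[d a] b] [[d' a'] b'] e.
have [|-> ->] := @ends_inj _ a b a' b'; first by move=> i j _; have := e (i, j, false).
by congr (_, _, _); apply/ffunP=> p; have := e (p, true).
Qed.

Lemma highest_root_BE (r : nat) (v : 'I_r) : highest_root_B r 0 v = (v < 2)%N%:Z.
Proof. by rewrite mxE; case: (v < 2)%N. Qed.

(** Read at the coordinate [v], the sum of the roots is the highest root exactly by the balance
    equation at the node [v]. *)
Lemma partition_ofP (r : nat) (x : config r) :
  balanced x -> is_partition (highest_root_B r) (partition_of x).
Proof.
move=> bx; rewrite /is_partition.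
under eq_bigr do rewrite ffunE.
rewrite sum_posroot; last by move=> y; exact: weight_invalid.
case: x bx => [[d a] b] /balancedP[d0 db].
apply/rowP=> v; rewrite sum_root_ofE /=; last by move=> i; rewrite d0.
rewrite sum_incidence_ends highest_root_BE addrAC -PoszD addnA db.
by rewrite PoszD addrK.
Qed.

Lemma partition_of_surj (r : nat) (hr : (2 <= r)%N) (m : {ffun PosRoot r -> nat}) :
  is_partition (highest_root_B r) m -> exists2 x, balanced x & m = partition_of x.
Proof.
pose w (y : rootidx r) := if valid y then m (posroot_of y) else 0%N.
have w0 y : ~~ valid y -> w y = 0%N by rewrite /w => /negPf ->.
have mw al : m al = w (index_of al).
  by rewrite /w (proj1 (index_ofP al)) index_ofK.
rewrite /is_partition; under eq_bigr do rewrite mw.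
rewrite sum_posroot // => /rowP H.
have {}H (v : 'I_r) : ((\sum_j w (v, j, true)) + \sum_p incidence v p * w (p, false) =
   (v < 2) + \sum_i w (i, v, true))%N.
  have := H v; rewrite sum_root_ofE; last by move=> i; rewrite w0 //= ltnn andbF.
  rewrite highest_root_BE addrAC -PoszD => /eqP.
  by rewrite subr_eq -PoszD => /eqP [].
have [| |a [b eab]] := @exists_ends _ (fun p => w (p, false)).
- move=> i j ji; apply: w0; rewrite /= negb_or -leqNgt (ltnW ji) /=.
  by rewrite andbT -val_eqE gtn_eqF.
(* Summing the equations [H] over all nodes cancels the edges. The sources add up to 2, because
   [2 <= r] makes both nodes 0 and 1 available. *)
- apply/eqP; rewrite -(eqn_add2l (\sum_v \sum_j w (v, j, true))).
  rewrite {2}exchange_big; apply/eqP.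
  under [X in (_ + X)%N]eq_bigr do rewrite -sum_incidence big_distrl.
  rewrite [X in (_ + X)%N]exchange_big -big_split /=.
  rewrite (eq_bigr _ (fun v _ => H v)) big_split /= addnC; congr (_ + _)%N.
  by case: r hr {w w0 mw m H} => [|[|r]] // _; rewrite !big_ord_recl big1.
exists ([ffun p => w (p, true)], a, b); last first.
  apply/ffunP=> al; rewrite ffunE mw; case: (index_of al) => p [] /=.
    by rewrite ffunE.
  exact: eab.
apply/balancedP; split=> [i j ji|v].
  by rewrite ffunE w0 //= andbF orbF -leqNgt.
under eq_bigr do rewrite ffunE; under [in RHS]eq_bigr do rewrite ffunE.
rewrite -H -addnA; congr (_ + _)%N; rewrite -sum_incidence_ends.
by apply: eq_bigr => p _; rewrite eab.
Qed.

(** * Juggling sequences as flows *)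

(* G u v balls are thrown from node u to node v, that is, at time u.+1 to
   height v - u; nodes r and r.+1 stand for the two final landing times. *)
Definition is_flow (r : nat) (G : nat -> nat -> nat) : Prop :=
  [/\ forall u v, (u < r)%N -> (v <= u)%N -> G u v = 0%N,
      forall u v, (u < r)%N -> (r.+2 <= v)%N -> G u v = 0%N,
      forall i, (i < r)%N -> (\sum_(v < r.+2) G i v = (i < 2) + \sum_(u < i) G u i)%N,
      (\sum_(u < r) G u r = 1)%N & (\sum_(u < r) G u r.+1 = 1)%N].

(* The number of balls at height p.+1 after i throws. *)
Definition occupancy (G : nat -> nat -> nat) (i p : nat) : nat :=
  ((i + p < 2) + \sum_(u < i) G u (i + p))%N.

(** This is the juggling step: the balls fall by one height, and those thrown at node [i] to land at
    [i.+1 + p] are added. *)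
Lemma occupancyS G i p :
  occupancy G i.+1 p = (occupancy G i p.+1 + G i (i.+1 + p))%N.
Proof. by rewrite /occupancy big_ord_recr /= addnA addSnnS. Qed.

(* Canonical states are exactly the coefficient lists of polynomials. *)
Definition state (r : nat) (G : nat -> nat -> nat) (i : nat) : jstate :=
  \poly_(p < r.+2) (occupancy G i p)%:Z.

Lemma canonical_state_poly (p : {poly int}) : canonical_state p.
Proof. exact: valP p. Qed.

Lemma canonical_state_inj (s t : jstate) :
  canonical_state s -> canonical_state t -> nth 0 s =1 nth 0 t -> s = t.
Proof.
move=> cs ct st; suff [] : Polynomial cs = Polynomial ct by [].
exact/polyP.
Qed.

(** Cutting the polynomial off at [r.+2] loses nothing, since no throw lands at node [r.+2] or
    later. *)
Lemma nth_state (r : nat) G i p : (2 <= r)%N -> is_flow r G -> (i <= r)%N ->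
  nth 0 (state r G i) p = (occupancy G i p)%:Z.
Proof.
move=> hr [_ G0 _ _ _] ir; rewrite coef_poly; case: ltnP => // rp.
rewrite /occupancy big1 ?addn0; last first.
  by move=> u _; apply: G0; [exact: leq_trans ir | exact: leq_trans (leq_addl _ _)].
by rewrite ltnNge (leq_trans _ (leq_addl i p)) // (leq_trans _ rp).
Qed.

Lemma nth_start p : nth 0 ([:: 1; 1] : jstate) p = (p < 2)%N%:Z.
Proof. by case: p => [|[|p]] //=; rewrite nth_nil. Qed.

Definition jseq_of (r : nat) (G : nat -> nat -> nat) : seq jstate :=
  mkseq (state r G) r.+1.

(** Substitute [v = i + k]. Both sums equal the sum of [F] below a bound [M] that exceeds both
    ranges, because [F] vanishes on the rest. *)
Lemma sum_shift (F : nat -> nat) (i n N : nat) :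
  (forall v, (v <= i)%N -> F v = 0%N) -> (forall v, (n <= v)%N -> F v = 0%N) ->
  (forall k, (N < k)%N -> F (i + k)%N = 0%N) ->
  (\sum_(1 <= k < N.+1) F (i + k) = \sum_(v < n) F v)%N.
Proof.
move=> F1 F2 F3; set M := (i + N.+1 + n)%N.
transitivity (\sum_(0 <= v < M) F v)%N; last first.
  rewrite (@big_cat_nat _ _ _ n) //= ?leq_addl // big_mkord [X in (_ + X)%N]big1_seq ?addn0 //.
  by move=> v; rewrite mem_index_iota => /andP[_ /andP[/F2 ->]].
symmetry; rewrite (@big_cat_nat _ _ _ i.+1) //=; last by rewrite /M; lia.
rewrite big1_seq ?add0n; last first.
  by move=> v; rewrite mem_index_iota => /andP[_ /andP[_ /F1 ->]].
rewrite (@big_cat_nat _ _ _ (i + N.+1)) //=; [|by lia|by rewrite /M; lia].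
rewrite [X in (_ + X)%N]big1_seq ?addn0; last first.
  move=> v; rewrite mem_index_iota => /andP[_ /andP[iv _]].
  by rewrite -(subnKC (leq_trans (leq_addr _ _) iv)) F3 //; lia.
rewrite -[i.+1]addn1 addnC -[(i + N.+1)%N]addnC big_addn addnK.
by apply: eq_bigr => k _; rewrite addnC.
Qed.

Lemma jseq_ofP (r : nat) G : (2 <= r)%N -> is_flow r G ->
  is_juggling_seq [:: 1; 1] [:: 1; 1] r (jseq_of r G).
Proof.
move=> hr fG; have [G1 G2 Gc Gr Gr1] := fG.
split; first by rewrite size_mkseq.
split; first by apply/allP => s /mapP[i _ ->]; exact: canonical_state_poly.
split.
  rewrite nth_mkseq //; apply: canonical_state_inj => // [|p].
    exact: canonical_state_poly.
  by rewrite nth_state // nth_start /occupancy big_ord0 addn0.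
split.
  rewrite nth_mkseq //; apply: canonical_state_inj => // [|p].
    exact: canonical_state_poly.
  (* By time [r >= 2] the initial balls have landed, so only throws to nodes [r] and [r.+1] remain
     in the air, one each. *)
  rewrite nth_state // nth_start /occupancy ltnNge (leq_trans hr) ?leq_addr //=.
  case: p => [|[|p]]; rewrite ?addn0 ?addn1 ?Gr ?Gr1 //.
  by rewrite big1 // => u _; apply: G2 => //; rewrite !addnS !ltnS leq_addr.
case=> // i; rewrite andTb succnK => ir; rewrite !nth_mkseq //; last exact: ltnW.
(* A throw to height [k] at node [i] lands at node [i + k]. *)
exists (fun k => G i (i + k)%N); split.
  have c0 k : (r.+2 < k)%N -> G i (i + k)%N = 0%N.
    by move=> rk; apply: G2 => //; rewrite (leq_trans (ltnW rk)) ?leq_addl.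
  exists r.+2; split=> //.
  rewrite (@sum_shift _ _ r.+2) => // [|v|v]; [|exact: G1|exact: G2].
  by rewrite Gc // /height nth_state ?(ltnW ir) // /occupancy addn0.
case=> // k _; rewrite /height /= !nth_state ?(ltnW ir) //.
by rewrite occupancyS addSnnS.
Qed.

Lemma jseq_of_surj (r : nat) (ss : seq jstate) : (2 <= r)%N ->
  is_juggling_seq [:: 1; 1] [:: 1; 1] r ss ->
  exists2 G, is_flow r G & ss = jseq_of r G.
Proof.
move=> hr [sz [/allP can [s0 [sr step]]]].
pose s i p := nth 0 (nth [::] ss i) p.
(* The throws are the excess of the new entry over the old entry one height above. The step relation
   makes this difference nonnegative, so [absz] does not change it. *)
pose G u v := if (u < v)%N then absz (s u.+1 (v - u.+1)%N - s u (v - u)%N) else 0%N.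
have GE i k (c : nat) : s i.+1 k = s i k.+1 + c%:Z -> G i (i + k.+1)%N = c.
  rewrite /G -addSnnS leq_addr addKn addSnnS addKn => ->.
  by rewrite addrAC subrr add0r.
have sE i p : (i <= r)%N -> s i p = (occupancy G i p)%:Z.
  elim: i p => [|i IH] p ir.
    by rewrite /s s0 nth_start /occupancy big_ord0 addn0.
  have [|c [_ cE]] := step i.+1; first by [].
  have e : s i.+1 p = s i p.+1 + (c p.+1)%:Z := cE p.+1 isT.
  by rewrite e occupancyS addSnnS (GE _ _ _ e) IH ?(ltnW ir).
(* The final state, read through [sE], fixes the number of throws landing at each node from [r] on:
   one at [r], one at [r.+1], none later. *)
have Gend p : (\sum_(u < r) G u (r + p) = (p < 2))%N.
  have := sE r p (leqnn r); rewrite /s sr nth_start /occupancy.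
  by rewrite [(r + p < 2)%N]ltnNge (leq_trans hr) ?leq_addr //= => -[].
have G1 u v : (v <= u)%N -> G u v = 0%N by rewrite /G leqNgt => /negPf ->.
have G2 u v : (u < r)%N -> (r.+2 <= v)%N -> G u v = 0%N.
  move=> ur rv; have := Gend (v - r)%N.
  rewrite subnKC; last by rewrite (leq_trans _ rv) // !leqW.
  rewrite (bigD1 (Ordinal ur)) //= ltnNge leq_subRL ?addn2 ?rv //=.
    by case: (G u v).
  by rewrite (leq_trans _ rv) // !leqW.
have fG : is_flow r G.
  split=> // [u v _|i ir||]; first exact: G1.
  - have [|c [[N [cN cs]] cE]] := step i.+1; first by [].
    have e k : G i (i + k.+1)%N = c k.+1 by apply: GE; exact: cE k.+1 isT.
    rewrite -(@sum_shift _ i _ N).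
    - rewrite big_nat (eq_bigr (fun k => c k)) -?big_nat; last by case.
      move: cs; rewrite /height /= -/(s i 0%N) sE ?(ltnW ir) // => -[->].
      by rewrite /occupancy addn0.
    - by move=> v; exact: G1.
    - by move=> v; exact: G2.
    - by case=> // k Nk; rewrite e cN.
  - by have := Gend 0%N; rewrite addn0.
  - by have := Gend 1%N; rewrite addn1.
exists G => //; apply: (@eq_from_nth _ [::]); first by rewrite size_mkseq.
move=> i; rewrite sz => ir; rewrite nth_mkseq //.
apply: canonical_state_inj; last by move=> p; rewrite nth_state //; exact: sE.
  by apply: can; rewrite mem_nth ?sz.
exact: canonical_state_poly.
Qed.

(** The states determine the occupancies, and by [occupancyS] consecutive occupancies determine the
    throws. *)
Lemma jseq_of_inj (r : nat) G G' : (2 <= r)%N -> is_flow r G -> is_flow r G' ->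
  jseq_of r G = jseq_of r G' -> forall u v, (u < r)%N -> G u v = G' u v.
Proof.
move=> hr fG fG' e u v ur.
have o i p : (i <= r)%N -> occupancy G i p = occupancy G' i p.
  move=> ir; have := congr1 (fun ss => nth 0 (nth [::] ss i) p) e.
  by rewrite !nth_mkseq // !nth_state // => -[].
have [vu|uv] := leqP v u.
  by case: fG fG' => [e1 _ _ _ _] [e2 _ _ _ _]; rewrite e1 ?e2.
have := o u.+1 (v - u.+1)%N ur.
rewrite !occupancyS o ?(ltnW ur) // subnKC // => /addnI //.
Qed.

(** * Flows from balanced configurations *)

(** The exit [a] becomes a throw to [r] and [b] a throw to [r.+1]; the two landing times are why the
    exits form an ordered pair. *)
Definition flow_of (r : nat) (x : config r) (u v : nat) : nat :=
  let: (d, a, b) := x in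
  if insub u is Some i then
    if v == r then nat_of_bool (i == a) else
    if v == r.+1 then nat_of_bool (i == b) else
    if insub v is Some j then d (i, j) else 0%N
  else 0%N.

Arguments flow_of : simpl never.

Lemma flow_of_ord (r : nat) d (a b i j : 'I_r) : flow_of (d, a, b) i j = d (i, j).
Proof. by rewrite /flow_of !valK !ltn_eqF // leqW. Qed.

Lemma flow_of_r (r : nat) d (a b i : 'I_r) : flow_of (d, a, b) i r = (i == a).
Proof. by rewrite /flow_of valK eqxx. Qed.

Lemma flow_of_r1 (r : nat) d (a b i : 'I_r) : flow_of (d, a, b) i r.+1 = (i == b).
Proof. by rewrite /flow_of valK gtn_eqF // eqxx. Qed.

Lemma flow_of_large (r : nat) (x : config r) u v : (r.+2 <= v)%N -> flow_of x u v = 0%N.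
Proof.
case: x => -[d a] b rv; rewrite /flow_of; case: insub => // i.
by rewrite !gtn_eqF ?(ltnW rv) // insubN // -leqNgt (ltnW (ltnW rv)).
Qed.

Lemma sum_eq_ord (r : nat) (a : 'I_r) : (\sum_(u < r) (u == a) = 1)%N.
Proof. by rewrite (bigD1 a) //= eqxx big1 // => u /negPf ->. Qed.

Lemma sum_below (r : nat) (i : 'I_r) (F : nat -> nat) :
  (forall u, (u < r)%N -> (i <= u)%N -> F u = 0%N) ->
  (\sum_(u < i) F u = \sum_(u < r) F u)%N.
Proof.
move=> F0; rewrite (big_ord_widen r F (ltnW (ltn_ord i))) big_mkcond /=.
by apply: eq_bigr => u _; case: ltnP => // /F0 ->.
Qed.

Lemma flow_ofP (r : nat) (x : config r) : balanced x -> is_flow r (flow_of x).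
Proof.
case: x => -[d a] b /balancedP[d0 db].
have low u v : (u < r)%N -> (v <= u)%N -> flow_of (d, a, b) u v = 0%N.
  move=> ur vu; have vr := leq_ltn_trans vu ur.
  by rewrite (flow_of_ord d a b (Ordinal ur) (Ordinal vr)) d0.
split=> // [u v _|i ir||]; first exact: flow_of_large.
(* The last two terms of the outflow are the two exits, which turns flow conservation into the
   balance equation. *)
- rewrite !big_ord_recr /= -[i]/(nat_of_ord (Ordinal ir)); set j := Ordinal ir.
  rewrite flow_of_r flow_of_r1 (@sum_below _ j (fun u => flow_of _ u j)); last first.
    by move=> u ur; exact: low.
  under eq_bigr do rewrite flow_of_ord; rewrite db.
  by under [in RHS]eq_bigr do rewrite flow_of_ord.
- by under eq_bigr do rewrite flow_of_r; exact: sum_eq_ord.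
- by under eq_bigr do rewrite flow_of_r1; exact: sum_eq_ord.
Qed.

Lemma sum_eq1 (r : nat) (F : nat -> nat) : (\sum_(u < r) F u = 1)%N ->
  exists a : 'I_r, forall u : 'I_r, F u = (u == a).
Proof.
move=> F1; have /sum_extract[a [F' [_ e /=]]] : (\sum_(u < r) 1 * F u = 1)%N.
  by under eq_bigr do rewrite mul1n.
move=> /(@addnI 1 _ 0) /eqP; rewrite sum_nat_eq0 => /forallP z.
by exists a => u; rewrite e; have := z u; rewrite mul1n /= => /eqP ->; rewrite addn0.
Qed.

(** The exits are recovered as the unique nodes that throw to [r] and to [r.+1]. *)
Lemma flow_of_surj (r : nat) G : is_flow r G ->
  exists2 x : config r, balanced x & forall u v, (u < r)%N -> flow_of x u v = G u v.
Proof.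
case=> G1 G2 Gc /(@sum_eq1 r (G ^~ r))[a Ga] /(@sum_eq1 r (G ^~ r.+1))[b Gb].
exists ([ffun p : 'I_r * 'I_r => G p.1 p.2], a, b).
  apply/balancedP; split=> [i j ji|v]; first by rewrite ffunE G1.
  have := Gc v (ltn_ord v); rewrite !big_ord_recr /= Ga Gb.
  rewrite (@sum_below _ v (fun u => G u v)); last by move=> u ur; exact: G1.
  move=> Gv; under [in RHS]eq_bigr do rewrite ffunE.
  by under [in LHS]eq_bigr do rewrite ffunE.
move=> u v ur; rewrite -[u]/(nat_of_ord (Ordinal ur)); set i := Ordinal ur.
have [vr|] := ltnP v r; first by rewrite (flow_of_ord _ _ _ i (Ordinal vr)) ffunE.
rewrite leq_eqVlt => /predU1P[<-|]; first by rewrite flow_of_r Ga.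
rewrite leq_eqVlt => /predU1P[<-|rv]; first by rewrite flow_of_r1 Gb.
by rewrite flow_of_large // G2.
Qed.

(** The states up to time [r] read [G] only at nodes [u < r]. *)
Lemma jseq_of_ext (r : nat) G G' :
  (forall u v, (u < r)%N -> G u v = G' u v) -> jseq_of r G = jseq_of r G'.
Proof.
move=> e; apply/eq_in_map => i; rewrite mem_iota ltnS => /andP[_ ir].
congr polyseq; apply/polyP => p; rewrite !coef_poly; case: ifP => // _.
rewrite /occupancy (eq_bigr (fun u : 'I_i => G' u (i + p)%N)) // => u _.
exact/e/(leq_trans (ltn_ord u)).
Qed.

Definition juggling_of (r : nat) (x : config r) : seq jstate := jseq_of r (flow_of x).

Lemma juggling_of_inj (r : nat) (x y : config r) : (2 <= r)%N ->
  balanced x -> balanced y -> juggling_of x = juggling_of y -> x = y.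
Proof.
move=> hr /flow_ofP fx /flow_ofP fy /(jseq_of_inj hr fx fy) {fx fy}.
case: x y => [[d a] b] [[d' a'] b'] e.
have da : a = a'.
  by have := e a r (ltn_ord a); rewrite !flow_of_r eqxx; case: eqP.
have db : b = b'.
  by have := e b r.+1 (ltn_ord b); rewrite !flow_of_r1 eqxx; case: eqP.
rewrite da db; congr (_, _, _); apply/ffunP=> -[i j].
by have := e i j (ltn_ord i); rewrite !flow_of_ord.
Qed.

Lemma juggling_of_surj (r : nat) (ss : seq jstate) : (2 <= r)%N ->
  is_juggling_seq [:: 1; 1] [:: 1; 1] r ss ->
  exists2 x : config r, balanced x & ss = juggling_of x.
Proof.
move=> hr /(jseq_of_surj hr)[G /flow_of_surj[x bx xG] ->].
by exists x => //; apply/esym/jseq_of_ext.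
Qed.

Theorem mainTheorem11 (r : nat) (hr : (2 <= r)%N) :
  (exists f : {m : {ffun PosRoot r -> nat} | is_partition (highest_root_B r) m} ->
              {ss : seq jstate | is_juggling_seq [:: 1; 1] [:: 1; 1] r ss},
     bijective f) /\
  (exists k : nat,
     has_card (is_partition (highest_root_B r)) k /\
     has_card (is_juggling_seq [:: 1; 1] [:: 1; 1] r) k).
Proof.
have [k cB] := has_card_balanced r.
have cP : has_card (is_partition (highest_root_B r)) k.
  apply: has_card_image cB; [exact: partition_of_inj|exact: partition_ofP|].
  by move=> m /(partition_of_surj hr).
have cJ : has_card (is_juggling_seq [:: 1; 1] [:: 1; 1] r) k.
  apply: has_card_image cB.
  - by move=> x y; exact: juggling_of_inj.
  - by move=> x /flow_ofP; exact: jseq_ofP.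
  - by move=> ss /(juggling_of_surj hr).
by split; [exact: has_card_bij cP cJ | exists k].
Qed.
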